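(* Let $\mathbb{P}$ be a probability measure on $\Omega=\mathcal{S}^{n\times n}\times\mathbb{R}_+\times\mathbb{R}_+$, write $\omega=(H,\Gamma,\gamma)\in\Omega$, and suppose $G=\mathbb{E}[\frac1\gamma H]$ exists and is positive definite. Let $f:\mathbb{R}^n\to\mathbb{R}$ be differentiable and strongly convex, with $\mu$-strong convexity ($\mu>0$) and $L$-Lipschitz gradients with respect to the $\|\cdot\|_{G^{-1}}$ norm. Suppose that for all fixed $x\in\mathbb{R}^n$ the following holds for almost every $\omega\in\Omega$: $$f(\Phi(x;\omega))\leq f(x)-\frac{1}{2\Gamma}\|\nabla f(x)\|_H^2,\qquad\Phi(x;\omega)=x-\frac1\Gamma H\nabla f(x).$$ Furthermore, suppose that $\nu>0$ satisfies $$\mathbb{E}\left[\frac{1}{\gamma^2}HG^{-1}H\right]\preccurlyeq\nu\,\mathbb{E}\left[\frac{1}{\gamma^2}H\right].$$ Let $\tau>0$ satisfy, for almost every $\omega\in\Omega$, $$\tau\leq\frac{\gamma}{\sqrt\Gamma}\sqrt{\frac{\mu}{\nu}},\qquad\tau\leq\sqrt{\frac{\mu}{L}}.$$ Let $\omega_k=(H_k,\Gamma_k,\gamma_k)$, $k\ge0$, be independent realizations from $\mathbb{P}$, and, starting from $y_0=z_0=x_0$ with $x_0$ fixed, let $\{(x_k,y_k,z_k)\}_{k\ge0}$ be defined by $$\tau(x_{k+1}-z_k)=y_k-x_{k+1},$$ $$y_{k+1}=x_{k+1}-\frac{1}{\Gamma_k}H_k\nabla f(x_{k+1}),$$ $$z_{k+1}-z_k=\tau\left(x_{k+1}-z_k-\frac{1}{\mu\gamma_k}H_k\nabla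 f(x_{k+1})\right).$$ With $f_*=\min_xf(x)$ attained at $x_*$, put $V_k=f(y_k)-f_*+\frac\mu2\|z_k-x_*\|_{G^{-1}}^2$. Then for all $k\geq0$, $$\mathbb{E}_k[V_{k+1}]\leq(1-\tau)V_k,$$ where $\mathbb{E}_k$ denotes expectation conditioned on $\mathcal{F}_k=\sigma(\omega_0,\omega_1,\dots,\omega_{k-1})$.
   Context: $\mathcal{S}^{n\times n}$ is the set of real $n\times n$ (symmetric) positive semi-definite matrices, $\mathbb{R}_+$ the positive reals, and $\mathbb{E}$ is expectation with respect to $\mathbb{P}$; the expectations appearing in the hypotheses are assumed to exist. For symmetric matrices, $M\preccurlyeq N$ means $N-M$ is positive semi-definite. $\|x\|_M=\sqrt{x^{T}Mx}$ for positive (semi-)definite $M$. $\mu$-strong convexity with respect to $\|\cdot\|_{G^{-1}}$ means $f(y)\ge f(x)+\langle\nabla f(x),y-x\rangle+\frac\mu2\|y-x\|_{G^{-1}}^2$ for all $x,y\in\mathbb{R}^n$; $L$-Lipschitz gradients with respect to $\|\cdot\|_{G^{-1}}$ means $f(y)\le f(x)+\langle\nabla f(x),y-x\rangle+\frac L2\|y-x\|_{G^{-1}}^2$ for all $x,y\in\mathbb{R}^n$. Here $\langle\cdot,\cdot\rangle$ is the Euclidean inner product and $\nabla f$ the Euclidean gradient. *)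

(* Defs.v *)
From HB Require Import structures.
From mathcomp Require Import all_boot all_order all_algebra.
From mathcomp Require Import all_classical all_reals all_analysis.
Set Implicit Arguments.
Unset Strict Implicit.
Unset Printing Implicit Defensive.
Import Order.TTheory GRing.Theory Num.Theory.
Import numFieldNormedType.Exports.
Local Open Scope classical_set_scope.
Local Open Scope ring_scope.

Definition dotv (R : realType) (n : nat) (u v : 'cV[R]_n) : R :=
  (u^T *m v) 0 0.

Definition posdefmx (R : realType) (n : nat) (M : 'M[R]_n) : Prop :=
  M \is symmetricmx /\ forall v : 'cV[R]_n, v != 0 -> 0 < dotv v (M *m v).

Definition possemidefmx (R : realType) (n : nat) (M : 'M[R]_n) : Prop :=
  M \is symmetricmx /\ forall v : 'cV[R]_n, 0 <= dotv v (M *m v).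

Definition loewner_le (R : realType) (n : nat) (M N : 'M[R]_n) : Prop :=
  possemidefmx (N - M).

Definition normM (R : realType) (n : nat) (M : 'M[R]_n) (x : 'cV[R]_n) : R :=
  Num.sqrt (dotv x (M *m x)).

(* The column vector of partial derivatives. The library's norm on 'cV[R]_n is
   the max norm; being equivalent to the Euclidean one, it gives the same
   notion of differentiability. *)
Definition grad (R : realType) (n : nat) (f : 'cV[R]_n -> R) (x : 'cV[R]_n) :
    'cV[R]_n :=
  \col_i 'D_(delta_mx i 0) f x.

Definition strongly_convex_wrt (R : realType) (n : nat) (M : 'M[R]_n) (mu : R)
    (f : 'cV[R]_n -> R) : Prop :=
  forall x y : 'cV[R]_n,
    f x + dotv (grad f x) (y - x) + mu / 2 * normM M (y - x) ^+ 2 <= f y.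

Definition lipschitz_grad_wrt (R : realType) (n : nat) (M : 'M[R]_n) (L : R)
    (f : 'cV[R]_n -> R) : Prop :=
  forall x y : 'cV[R]_n,
    f y <= f x + dotv (grad f x) (y - x) + L / 2 * normM M (y - x) ^+ 2.

Record sample (R : realType) (n : nat) := Sample {
  smp_H : 'M[R]_n ;
  smp_Gamma : R ;
  smp_gamma : R ;
  smp_H_psd : possemidefmx smp_H ;
  smp_Gamma_gt0 : 0 < smp_Gamma ;
  smp_gamma_gt0 : 0 < smp_gamma }.

Section sample_space.
Variables (R : realType) (n : nat).

Lemma possemidefmx0 : possemidefmx (0 : 'M[R]_n).
Proof.
split=> [|v]; first by apply/is_hermitianmxP; rewrite trmx0 map_mx0 scaler0.
by rewrite mul0mx /dotv mulmx0 mxE.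
Qed.

HB.instance Definition _ := gen_eqMixin (sample R n).
HB.instance Definition _ := gen_choiceMixin (sample R n).
HB.instance Definition _ := isPointed.Build (sample R n)
  (Sample possemidefmx0 ltr01 ltr01).

Definition sample_generators : set (set (sample R n)) :=
  \bigcup_(ij in [set: 'I_n * 'I_n])
    preimage_set_system setT (fun w => smp_H w ij.1 ij.2) measurable
  `|` preimage_set_system setT (@smp_Gamma R n) measurable
  `|` preimage_set_system setT (@smp_gamma R n) measurable.

(* The coordinates generate the trace on the sample space of the Borel
   sigma-algebra of 'M[R]_n * R * R. *)
Definition Omega := g_sigma_algebraType sample_generators.

End sample_space.

Definition mx_integrable (d : measure_display) (T : measurableType d)
    (R : realType) (P : probability T R) (n : nat) (X : T -> 'M[R]_n) : Prop :=
  forall i j, P.-integrable setT (EFin \o (fun w => X w i j)).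

Definition mx_expectation (d : measure_display) (T : measurableType d)
    (R : realType) (P : probability T R) (n : nat) (X : T -> 'M[R]_n) :
    'M[R]_n :=
  \matrix_(i, j) fine 'E_P[fun w => X w i j].

Definition mutually_independent (d d' : measure_display)
    (W : measurableType d) (T : measurableType d') (R : realType)
    (Q : probability W R) (X : nat -> {RV Q >-> T}) : Prop :=
  forall (J : seq nat) (A : nat -> set T),
    uniq J -> (forall j, measurable (A j)) ->
    Q (\big[setI/setT]_(j <- J) (X j @^-1` A j)) =
    (\prod_(j <- J) Q (X j @^-1` A j))%E.

(* Z is a version of the expectation of X conditioned on the sigma-algebra F.
   The library's integral is total, so the integrability of X has to be part
   of the definition. *)
Definition is_cond_expectation (d : measure_display) (W : measurableType d)
    (R : realType) (Q : probability W R) (F : set (set W)) (X Z : W -> R) :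
    Prop :=
  [/\ Q.-integrable setT (EFin \o X),
      Q.-integrable setT (EFin \o Z),
      forall B : set R, measurable B -> F (Z @^-1` B) &
      forall A : set W, F A ->
        (\int[Q]_(w in A) (Z w)%:E = \int[Q]_(w in A) (X w)%:E)%E].

(* Main.v *)
Require Import Defs.
From HB Require Import structures.
From mathcomp Require Import all_boot all_order all_algebra.
From mathcomp Require Import all_classical all_reals all_analysis.
From mathcomp Require Import measurable_realfun.
From mathcomp Require Import ring lra.
Set Implicit Arguments.
Unset Strict Implicit.
Unset Printing Implicit Defensive.
Import Order.TTheory GRing.Theory Num.Theory.
Import numFieldNormedType.Exports.
Local Open Scope classical_set_scope.
Local Open Scope ring_scope.

(** The argument has a deterministic core, an averaging step and a conditioning
step.

Averaging ([one_step_expectation]): fix y, z and let x = [coupling tau y z],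
g the gradient at x, N the inverse of G and a = z + tau (x - z) - xs.  For almost
every sample, the descent property together with the bound on tau
([step_size_bound]) gives
  f(y+) <= f(x) - tau^2 nu / (2 mu) * <g, gamma^-2 H g>,
while expanding the square gives, with q the quadratic form of N,
  mu/2 q(z+ - xs) = mu/2 q(a) - tau <N a, gamma^-1 H g>
                    + tau^2 / (2 mu) * <g, gamma^-2 H N H g>.
Every random term is a matrix coefficient of a matrix with known mean.  The mean
of gamma^-1 H is G, which N cancels, and the hypothesis on nu says precisely that
the mean of the last term is dominated by the decrease of f.  What remains is
  f(x) - fs + mu/2 q(a) - tau <a, g>,
and strong convexity at x, tested against y and against the minimizer, bounds it
by (1 - tau) times the Lyapunov value at (y, z) ([nesterov_contraction]); this is
where the coupling tau (x - z) = y - x enters.  Comparing the two quadratic bounds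
on f along one nonzero direction gives mu <= L, hence tau <= 1
([modulus_le1]);
in dimension 0 the Lyapunov function is identically 0.

Conditioning ([freezing]): the k-th iterates are measurable functions of the first
k samples, and the k-th sample is independent of these.  Hence, by Tonelli on the
product of the past with the sample space, averaging over the k-th sample with
the past frozen yields a version of the conditional expectation.  The averaged
bound then holds pointwise for this version, integrability follows by induction on
k, and any other version agrees with it almost everywhere
([cond_expectation_unique]).

Measurability is taken coordinatewise on column vectors: a continuous function of
a measurable vector is a limit of functions of the vector rounded to finer and
finer grids, and the gradient is a limit of difference quotients. *)

(** * The inner product and quadratic forms *)

Section bilinear.
Variables (R : realType) (n : nat).
Implicit Types (u v w : 'cV[R]_n) (M : 'M[R]_n) (a : R).

Lemma dotvC u v : dotv u v = dotv v u.
Proof. by rewrite /dotv -[u^T *m v]trmxK trmx_mul trmxK mxE. Qed.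

Lemma dotvDr u v w : dotv u (v + w) = dotv u v + dotv u w.
Proof. by rewrite /dotv mulmxDr mxE. Qed.

Lemma dotvZr a u v : dotv u (a *: v) = a * dotv u v.
Proof. by rewrite /dotv -scalemxAr mxE. Qed.

Lemma dotvBr u v w : dotv u (v - w) = dotv u v - dotv u w.
Proof. by rewrite -scaleN1r dotvDr dotvZr mulN1r. Qed.

Lemma dotvDl u v w : dotv (v + w) u = dotv v u + dotv w u.
Proof. by rewrite !(dotvC _ u) dotvDr. Qed.

Lemma dotvZl a u v : dotv (a *: v) u = a * dotv v u.
Proof. by rewrite !(dotvC _ u) dotvZr. Qed.

Lemma dotvBl u v w : dotv (v - w) u = dotv v u - dotv w u.
Proof. by rewrite !(dotvC _ u) dotvBr. Qed.

Lemma dotvNr u v : dotv u (- v) = - dotv u v.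
Proof. by rewrite -scaleN1r dotvZr mulN1r. Qed.

Lemma dotvNl u v : dotv (- v) u = - dotv v u.
Proof. by rewrite !(dotvC _ u) dotvNr. Qed.

Definition dotvE := (dotvDr, dotvBr, dotvNr, dotvZr,
  dotvDl, dotvBl, dotvNl, dotvZl).

Lemma dotv_sum u v : dotv u v = \sum_i u i 0 * v i 0.
Proof. by rewrite /dotv mxE; apply: eq_bigr => i _; rewrite mxE. Qed.

Lemma dotv_mulmx_sum u M v :
  dotv u (M *m v) = \sum_(p : 'I_n * 'I_n) u p.1 0 * v p.2 0 * M p.1 p.2.
Proof.
rewrite dotv_sum -(pair_bigA _ (fun i j => u i 0 * v j 0 * M i j)) /=.
apply: eq_bigr => i _; rewrite mxE mulr_sumr.
by apply: eq_bigr => j _; rewrite mulrCA mulrC.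
Qed.

Lemma symmetricmxP M : M \is symmetricmx <-> M^T = M.
Proof.
have idM (N : 'M[R]_n) : map_mx idfun N = N by apply/matrixP => i j; rewrite mxE.
by split=> [/is_hermitianmxP|MT]; [|apply/is_hermitianmxP];
  rewrite expr0 scale1r idM ?MT.
Qed.

Lemma dotv_symmx M u v : M \is symmetricmx ->
  dotv u (M *m v) = dotv (M *m u) v.
Proof. by move=> /symmetricmxP MT; rewrite /dotv trmx_mul MT mulmxA. Qed.

Lemma dotv_sub_mulmx u v (b : R) M (H : 'M[R]_n) :
  M \is symmetricmx -> H \is symmetricmx ->
  dotv (u - b *: (H *m v)) (M *m (u - b *: (H *m v))) =
  dotv u (M *m u) - 2 * b * dotv (M *m u) (H *m v)
    + b ^+ 2 * dotv v ((H *m M *m H) *m v).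
Proof.
move=> sM sH; rewrite mulmxBr -scalemxAr !dotvE -!mulmxA.
rewrite (dotv_symmx u (H *m v) sM) (dotv_symmx v _ sH).
rewrite (dotvC (H *m v) (M *m u)).
ring.
Qed.

Lemma posdefmxW M : posdefmx M -> possemidefmx M.
Proof.
move=> [sM M0]; split=> // v; have [->|/M0/ltW//] := eqVneq v 0.
by rewrite mulmx0 /dotv mulmx0 mxE.
Qed.

Lemma posdefmx_unit M : posdefmx M -> M \in unitmx.
Proof.
move=> [/symmetricmxP sM M0]; rewrite unitmxE unitfE; apply/det0P => -[v v0 vM].
have vT0 : v^T != 0 by rewrite trmx_eq0.
by have := M0 _ vT0; rewrite -{1}sM -trmx_mul vM trmx0 /dotv mulmx0 mxE ltxx.
Qed.

(** Writing v = M w turns the form of the inverse at v into the form of M at w. *)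
Lemma posdefmx_inv M : posdefmx M -> posdefmx (invmx M).
Proof.
move=> pM; have uM := posdefmx_unit pM; have [sM M0] := pM.
split=> [|v v0]; first by apply/symmetricmxP; rewrite trmx_inv;
  rewrite (proj1 (symmetricmxP _) sM).
rewrite -{1}(mulKVmx uM v) -dotv_symmx//; apply: M0.
by apply: contra_neq v0 => w0; rewrite -(mulKVmx uM v) w0 mulmx0.
Qed.

Lemma normM_sqr M v : possemidefmx M -> normM M v ^+ 2 = dotv v (M *m v).
Proof. by move=> [_ M0]; rewrite sqr_sqrtr. Qed.

End bilinear.

(** * The deterministic contraction *)

Section deterministic.
Variables (R : realType) (n : nat).
Implicit Types (u v x y z g : 'cV[R]_n) (N : 'M[R]_n).

(** With s = z - x and t = x - xs one has a = (1 - tau) s + t and y - x = - tau s.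
The bound is (1 - tau) times the hypothesis on fy plus tau times the hypothesis
on fs, up to the nonnegative term
mu / 2 * tau * (1 - tau) * (1 + tau) * <s, N s>. *)
Lemma nesterov_contraction N mu tau x y z xs g (fx fy fs : R) :
  possemidefmx N -> 0 <= mu -> 0 <= tau <= 1 ->
  tau *: (x - z) = y - x ->
  fx + dotv g (y - x) + mu / 2 * dotv (y - x) (N *m (y - x)) <= fy ->
  fx + dotv g (xs - x) + mu / 2 * dotv (xs - x) (N *m (xs - x)) <= fs ->
  let a := z + tau *: (x - z) - xs in
  fx - fs + mu / 2 * dotv a (N *m a) - tau * dotv a g
    <= (1 - tau) * (fy - fs + mu / 2 * dotv (z - xs) (N *m (z - xs))).
Proof.
move=> N0 mu0 /andP[t0 t1] xyz; rewrite -xyz; pose s := z - x; pose t := x - xs.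
have -> : x - z = - s by rewrite opprB.
have -> : xs - x = - t by rewrite opprB.
have -> : z - xs = s + t by rewrite /s /t addrA subrK.
have -> : z + tau *: (- s) - xs = (1 - tau) *: s + t.
  rewrite scalerBl scale1r scalerN /s /t.
  by rewrite addrAC -[RHS]addrAC addrA subrK.
(* linearity is to expand in [s] and [t], without looking inside them *)
cbv zeta; clearbody s t.
have Nts : dotv t (N *m s) = dotv s (N *m t).
  by rewrite dotv_symmx ?(proj1 N0)// dotvC.
have s0 := proj2 N0 s.
rewrite !scalerN !mulmxN !mulmxDr -!scalemxAr !dotvE Nts ![dotv g _]dotvC.
move: (dotv s (N *m s)) (dotv s (N *m t)) (dotv t (N *m t)) s0.
move: (dotv s g) (dotv t g) => sg tg ss st tt ss0 h1 h2.
have c0 : 0 <= 1 - tau by rewrite subr_ge0.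
have k1 := ler_wpM2l c0 h1; have k2 := ler_wpM2l t0 h2.
have k3 : 0 <= mu / 2 * ((1 - tau) * tau * ss * (1 + tau)).
  by rewrite !mulr_ge0 ?invr_ge0// addr_ge0.
lra.
Qed.

(** The lower and upper quadratic bounds on f at 0, compared along a nonzero
vector, force mu <= L. *)
Lemma modulus_le1 N mu L tau (f : 'cV[R]_n -> R) : (0 < n)%N ->
  posdefmx N -> 0 < mu ->
  strongly_convex_wrt N mu f -> lipschitz_grad_wrt N L f ->
  tau <= Num.sqrt (mu / L) -> tau <= 1.
Proof.
move=> n0 pN mu0 sc lg /le_trans; apply.
pose v : 'cV[R]_n := const_mx 1.
have v0 : v != 0.
  by apply/eqP => /matrixP/(_ (Ordinal n0) 0)/eqP; rewrite !mxE oner_eq0.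
have q0 := proj2 pN v v0.
have := le_trans (sc 0 v) (lg 0 v).
rewrite subr0 normM_sqr ?lerD2l ?ler_pM2r ?invr_gt0//; last exact: posdefmxW.
move=> muL; rewrite -sqrtr1 ler_sqrt// ler_pdivrMr ?mul1r//.
exact: lt_le_trans muL.
Qed.

End deterministic.

(** * Coordinatewise measurability *)

Section measurability.
Context d (T : measurableType d) (R : realType).

(** Measurability for the product of the Borel sigma-algebras on the entries. *)
Definition mx_measurable m n (X : T -> 'M[R]_(m, n)) :=
  forall i j, measurable_fun [set: T] (fun w => X w i j).

Lemma mx_measurable_cst m n (A : 'M[R]_(m, n)) : mx_measurable (fun=> A).
Proof. by move=> i j; exact: measurable_cst. Qed.

Lemma mx_measurableD m n (X Y : T -> 'M[R]_(m, n)) :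
  mx_measurable X -> mx_measurable Y -> mx_measurable (fun w => X w + Y w).
Proof.
move=> mX mY i j; under eq_fun do rewrite mxE.
exact: measurable_funD (mX i j) (mY i j).
Qed.

Lemma mx_measurableZ m n (a : T -> R) (X : T -> 'M[R]_(m, n)) :
  measurable_fun setT a -> mx_measurable X ->
  mx_measurable (fun w => a w *: X w).
Proof.
move=> ma mX i j; under eq_fun do rewrite mxE.
exact: measurable_funM ma (mX i j).
Qed.

Lemma mx_measurableB m n (X Y : T -> 'M[R]_(m, n)) :
  mx_measurable X -> mx_measurable Y -> mx_measurable (fun w => X w - Y w).
Proof.
move=> mX mY; apply: mx_measurableD => // i j.
under eq_fun do rewrite mxE; exact: measurableT_comp (mY i j).
Qed.

Lemma mx_measurableM m n p (X : T -> 'M[R]_(m, n)) (Y : T -> 'M[R]_(n, p)) :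
  mx_measurable X -> mx_measurable Y -> mx_measurable (fun w => X w *m Y w).
Proof.
move=> mX mY i j; under eq_fun do rewrite mxE.
apply: measurable_sum => l; exact: measurable_funM (mX i l) (mY l j).
Qed.

Lemma mx_measurable_trmx m n (X : T -> 'M[R]_(m, n)) :
  mx_measurable X -> mx_measurable (fun w => (X w)^T).
Proof. by move=> mX i j; under eq_fun do rewrite mxE; exact: mX. Qed.

Lemma measurable_dotv n (X Y : T -> 'cV[R]_n) :
  mx_measurable X -> mx_measurable Y ->
  measurable_fun setT (fun w => dotv (X w) (Y w)).
Proof.
by move=> mX mY; apply: mx_measurableM mY _ _; exact: mx_measurable_trmx.
Qed.

(** The inverse is not continuous at 0, but on positive numbers it is the real
power of exponent -1, which is measurable. *)
Lemma measurable_fun_inv (a : T -> R) : (forall w, 0 < a w) ->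
  measurable_fun setT a -> measurable_fun setT (fun w => (a w)^-1).
Proof.
move=> a0 ma; under eq_fun do rewrite -powR_inv1 ?ltW//.
exact: (measurableT_comp (@measurable_powR R (-1)) ma).
Qed.

(** The corner of the grid of mesh 1 / (m + 1) just below v, in integer coordinates
([round]) and as a vector ([grid]). *)
Let round n m (v : 'cV[R]_n) : {ffun 'I_n -> int} :=
  [ffun i => Num.floor (m.+1%:R * v i 0)].
Let grid n m (k : {ffun 'I_n -> int}) : 'cV[R]_n :=
  \col_i ((k i)%:~R / m.+1%:R).

Let round_cvg n (v : 'cV[R]_n) : grid m (round m v) @[m --> \oo] --> v.
Proof.
move=> A [B nB BA]; suff : \forall m \near \oo, forall i, B i 0 (grid m (round m v) i 0).
  apply: filterS => m mB; apply: BA => i j; rewrite ord1; exact: mB.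
apply: filter_forall => i.
have /(_ (B i 0)) : (grid m (round m v) i 0 @[m --> \oo] --> v i 0).
  have h0 : (v i 0 - harmonic m) @[m --> \oo] --> v i 0.
    rewrite -[X in _ --> X]subr0; apply: cvgB; first exact: cvg_cst.
    exact: cvg_harmonic.
  apply: (squeeze_cvgr _ h0 (cvg_cst _)); near=> m; rewrite !mxE ffunE.
  have m0 : 0 < m.+1%:R :> R by rewrite ltr0n.
  have /andP[f1 f2] := floor_itv (m.+1%:R * v i 0).
  rewrite intrD in f2; rewrite /= lerBlDr -{2}div1r -mulrDl ler_pdivlMr//.
  by rewrite ler_pdivrMr// [v i 0 * _]mulrC f1 ltW.
by apply; exact: nB.
Unshelve. all: by end_near. Qed.

(** The rounded X takes countably many values, each on a measurable set, so f of the
rounded X is measurable; continuity of f gives the limit. *)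
Lemma measurable_continuous_comp n (f : 'cV[R]_n -> R) (X : T -> 'cV[R]_n) :
  continuous f -> mx_measurable X -> measurable_fun setT (fun w => f (X w)).
Proof.
move=> cf mX.
apply: (@measurable_fun_cvg _ _ _ _ (fun m w => f (grid m (round m (X w))))); last first.
  by move=> w _; apply: continuous_cvg; [exact: cf|exact: round_cvg].
move=> m _ B mB; rewrite setTI.
rewrite [X in measurable X](_ : _ =
  \bigcup_k [set w | round m (X w) = k /\ B (f (grid m k))]); last first.
  by apply/seteqP; split=> [w Bw|w [k _ [<-]]//]; exists (round m (X w)).
apply: countable_bigcupT_measurable => [|k]; first exact: countableP.
have [Bk|nBk] := pselect (B (f (grid m k))); last first.
  by rewrite [X in measurable X](_ : _ = set0)//; apply/seteqP; split=> // w [].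
rewrite [X in measurable X](_ : _ = \bigcap_(i in [set: 'I_n])
   ((fun w => m.+1%:R * X w i 0) @^-1` `[(k i)%:~R, (k i + 1)%:~R[)); last first.
  apply/seteqP; split=> [w [<- _] i _ /=|w kw].
    by rewrite in_itv/= ffunE; exact: floor_itv.
  split=> //; apply/ffunP => i; rewrite ffunE; apply/eqP.
  by have := kw i I; rewrite /= in_itv/= => /floor_def ->.
apply: fin_bigcap_measurable => // i _.
rewrite -[X in measurable X]setTI.
by apply: (measurable_funM (measurable_cst _) (mX i 0)).
Qed.

Lemma mx_measurable_grad n (f : 'cV[R]_n -> R) (X : T -> 'cV[R]_n) :
  (forall x, differentiable f x) -> mx_measurable X ->
  mx_measurable (fun w => grad f (X w)).
Proof.
move=> df mX i j; under eq_fun do rewrite mxE.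
have cf : continuous f by move=> x; exact: differentiable_continuous.
pose e := delta_mx i 0 : 'cV[R]_n.
(* difference quotients along the increments 1 / (m + 1) *)
apply: (@measurable_fun_cvg _ _ _ _
   (fun m w => m.+1%:R * (f (m.+1%:R^-1 *: e + X w) - f (X w)))) => [m|w _].
  apply: measurable_funM => //; apply: measurable_funB.
    exact: (measurable_continuous_comp cf
              (mx_measurableD (@mx_measurable_cst _ _ (m.+1%:R^-1 *: e)) mX)).
  exact: measurable_continuous_comp.
have /cvg_ex[l fl] : derivable f (X w) e by exact: diff_derivable.
rewrite /derive (cvg_lim _ fl)//.
have /cvgr_dnbhsP/(_ harmonic) := fl.
have h : (forall n, @harmonic R n != 0) /\ @harmonic R n @[n --> \oo] --> 0.
  by split=> [m|]; [rewrite gt_eqF// harmonic_gt0|exact: cvg_harmonic].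
move=> /(_ h); apply: cvg_trans; apply: near_eq_cvg; near=> m.
by rewrite /harmonic/= invrK.
Unshelve. all: by end_near. Qed.

End measurability.

Section sample_measurability.
Variables (R : realType) (n : nat).

Lemma mx_measurable_smp_H : mx_measurable (@smp_H R n : Omega R n -> _).
Proof.
move=> i j _ B mB; apply: sub_sigma_algebra; left; left.
by exists (i, j) => //; exists B.
Qed.

Lemma measurable_smp_Gamma :
  measurable_fun setT (@smp_Gamma R n : Omega R n -> R).
Proof. by move=> _ B mB; apply: sub_sigma_algebra; left; right; exists B. Qed.

Lemma measurable_smp_gamma :
  measurable_fun setT (@smp_gamma R n : Omega R n -> R).
Proof. by move=> _ B mB; apply: sub_sigma_algebra; right; exists B. Qed.

End sample_measurability.

(** * Means of linear expressions *)

Section mean.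
Context d (T : measurableType d) (R : realType) (P : probability T R).

(** Integrability and the value of the integral together, so that both propagate
through linear combinations at once. *)
Definition has_mean (X : T -> R) (m : R) :=
  P.-integrable setT (EFin \o X) /\ (\int[P]_w (X w)%:E = m%:E)%E.

Lemma has_mean_cst c : has_mean (fun=> c) c.
Proof.
split; last by rewrite integral_cst//= probability_setT mule1.
exact: finite_measure_integrable_cst.
Qed.

Lemma has_meanD X Y a b :
  has_mean X a -> has_mean Y b -> has_mean (fun w => X w + Y w) (a + b).
Proof.
move=> [iX eX] [iY eY]; split; first exact: (integrableD measurableT iX iY).
by rewrite integralD_EFin// eX eY.
Qed.

Lemma has_meanZ c X a : has_mean X a -> has_mean (fun w => c * X w) (c * a).
Proof.
move=> [iX eX]; split; first exact: (integrableZl measurableT c iX).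
by under eq_integral do rewrite EFinM; rewrite integralZl// eX.
Qed.

Lemma has_mean_sum (I : finType) (X : I -> T -> R) (a : I -> R) :
  (forall i, has_mean (X i) (a i)) ->
  has_mean (fun w => \sum_i X i w) (\sum_i a i).
Proof.
move=> Xa; elim: (index_enum I) => [|i s IHs].
  rewrite big_nil; under eq_fun do rewrite big_nil; exact: has_mean_cst.
rewrite big_cons; under eq_fun do rewrite big_cons.
exact: has_meanD (Xa i) IHs.
Qed.

Lemma has_mean_dotv n (X : T -> 'M[R]_n) u v : mx_integrable P X ->
  has_mean (fun w => dotv u (X w *m v)) (dotv u (mx_expectation P X *m v)).
Proof.
move=> iX; rewrite dotv_mulmx_sum; under eq_fun do rewrite dotv_mulmx_sum.
apply: has_mean_sum => -[i j] /=; apply: has_meanZ; split; first exact: iX.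
by rewrite mxE unlock fineK//; apply: integrable_fin_num (iX i j).
Qed.

(** The upper bound h may be negative on a null set, so the monotonicity of the
integral of nonnegative functions is applied to its positive part. *)
Lemma ae_le_mean (V h : T -> R) m : (forall w, 0 <= V w) ->
  measurable_fun setT V -> {ae P, forall w, V w <= h w} -> has_mean h m ->
  (\int[P]_w (V w)%:E <= m%:E)%E.
Proof.
move=> V0 mV Vh [ih <-]; have mh := measurable_int _ ih.
apply: (@le_trans _ _ (\int[P]_w (EFin \o h)^\+ w)%E).
  apply: ae_ge0_le_integral => //.
  - by move=> w _; rewrite lee_fin.
  - exact/measurable_EFinP.
  - exact: measurable_funepos.
  - by apply: filterS Vh => w Vw _; rewrite funeposE le_max lee_fin Vw.
rewrite le_eqVlt; apply/orP; left; apply/eqP/ae_eq_integral => //.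
- exact: measurable_funepos.
- apply: filterS Vh => w Vw _; rewrite funeposE; apply/max_idPl.
  by rewrite lee_fin (le_trans (V0 w)).
Qed.

End mean.

(** * One step of the method in mean *)

Section method.
Variables (R : realType) (n : nat) (f : 'cV[R]_n -> R).
Variables (mu tau fs : R) (N : 'M[R]_n) (xs : 'cV[R]_n).

(** The solution x of tau (x - z) = y - x for positive tau; see [couplingP]. *)
Definition coupling (y z : 'cV[R]_n) := (1 + tau)^-1 *: (y + tau *: z).

Definition next_y (x : 'cV[R]_n) (w : sample R n) :=
  x - (smp_Gamma w)^-1 *: (smp_H w *m grad f x).

Definition next_z (x z : 'cV[R]_n) (w : sample R n) :=
  z + tau *: (x - z - (mu * smp_gamma w)^-1 *: (smp_H w *m grad f x)).

Definition lyapunov (y z : 'cV[R]_n) :=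
  f y - fs + mu / 2 * normM N (z - xs) ^+ 2.

(** The Lyapunov value after one step from (y, z) driven by the sample w. *)
Definition next_lyapunov (y z : 'cV[R]_n) (w : sample R n) :=
  lyapunov (next_y (coupling y z) w) (next_z (coupling y z) z w).

Lemma couplingP x y z : 0 < tau ->
  tau *: (x - z) = y - x <-> x = coupling y z.
Proof.
move=> t0; have t1 : 1 + tau != 0 by rewrite gt_eqF// addr_gt0.
have e : tau *: (x - z) - (y - x) = (1 + tau) *: x - (y + tau *: z).
  rewrite scalerBr scalerDl scale1r opprB opprD addrACA [tau *: x + x]addrC.
  by rewrite [- (tau *: z) - y]addrC.
split=> [/eqP|xE].
  by rewrite -subr_eq0 e subr_eq0 /coupling => /eqP <-; rewrite scalerK.
by apply/eqP; rewrite -subr_eq0 e xE /coupling scalerA mulfV// scale1r subrr.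
Qed.

Hypothesis fs_le : forall u, fs <= f u.
Hypothesis mu_ge0 : 0 <= mu.

Lemma lyapunov_ge0 y z : 0 <= lyapunov y z.
Proof. by rewrite addr_ge0 ?subr_ge0// mulr_ge0 ?sqr_ge0// divr_ge0. Qed.

Hypothesis df : forall x, differentiable f x.
Hypothesis N_psd : possemidefmx N.

Section measurable.
Context d (T : measurableType d) (y z : T -> 'cV[R]_n) (om : T -> Omega R n).
Hypotheses (my : mx_measurable y) (mz : mx_measurable z).
Hypothesis mom : measurable_fun setT om.

Lemma mx_measurable_coupling : mx_measurable (fun w => coupling (y w) (z w)).
Proof.
apply: mx_measurableZ; first exact: measurable_cst.
by apply: mx_measurableD => //; apply: mx_measurableZ => //; exact: measurable_cst.
Qed.

Let mH : mx_measurable (fun w => smp_H (om w)).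
Proof. by move=> i j; exact: measurableT_comp (mx_measurable_smp_H i j) mom. Qed.

Lemma mx_measurable_next_y : mx_measurable (fun w => next_y (y w) (om w)).
Proof.
apply: mx_measurableB => //; apply: mx_measurableZ; last first.
  by apply: mx_measurableM => //; exact: mx_measurable_grad.
apply: measurable_fun_inv => [w|]; first exact: smp_Gamma_gt0.
exact: measurableT_comp (@measurable_smp_Gamma R n) mom.
Qed.

Lemma mx_measurable_next_z : 0 < mu ->
  mx_measurable (fun w => next_z (y w) (z w) (om w)).
Proof.
move=> mu_gt0; apply: mx_measurableD => //; apply: mx_measurableZ.
  exact: measurable_cst.
apply: mx_measurableB; first exact: mx_measurableB.
apply: mx_measurableZ; last first.
  by apply: mx_measurableM => //; exact: mx_measurable_grad.
apply: measurable_fun_inv => [w|]; first by rewrite mulr_gt0// smp_gamma_gt0.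
apply: measurable_funM; first exact: measurable_cst.
exact: measurableT_comp (@measurable_smp_gamma R n) mom.
Qed.

Lemma measurable_lyapunov : measurable_fun setT (fun w => lyapunov (y w) (z w)).
Proof.
have cf : continuous f by move=> x; exact: differentiable_continuous.
apply: measurable_funD.
  apply: measurable_funB; last exact: measurable_cst.
  exact: measurable_continuous_comp.
apply: measurable_funM; first exact: measurable_cst.
under eq_fun do rewrite normM_sqr//.
have mzx : mx_measurable (fun w => z w - xs).
  by apply: mx_measurableB => //; exact: mx_measurable_cst.
by apply: measurable_dotv => //; apply: mx_measurableM.
Qed.

End measurable.

Lemma measurable_next_lyapunov d (T : measurableType d) (y z : T -> 'cV[R]_n)
    (om : T -> Omega R n) : 0 < mu ->
  mx_measurable y -> mx_measurable z -> measurable_fun setT om ->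
  measurable_fun setT (fun w => next_lyapunov (y w) (z w) (om w)).
Proof.
move=> mu_gt0 my mz mom; have mx := mx_measurable_coupling my mz.
apply: measurable_lyapunov; first exact: mx_measurable_next_y.
exact: mx_measurable_next_z.
Qed.

End method.

Section one_step.
Variables (R : realType) (n : nat) (P : probability (Omega R n) R).
Variables (G : 'M[R]_n) (f : 'cV[R]_n -> R) (mu nu tau fs : R).
Variable (xs : 'cV[R]_n).
Hypothesis G_mean : G = mx_expectation P (fun w => (smp_gamma w)^-1 *: smp_H w).
Hypothesis G_int : mx_integrable P (fun w => (smp_gamma w)^-1 *: smp_H w).
Hypothesis G_pd : posdefmx G.
Hypotheses (mu_gt0 : 0 < mu) (nu_gt0 : 0 < nu) (tau01 : 0 < tau <= 1).
Hypothesis df : forall x, differentiable f x.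
Hypothesis f_sc : strongly_convex_wrt (invmx G) mu f.
Hypothesis f_desc : forall x, {ae P, forall w,
  f (next_y f x w)
    <= f x - (2 * smp_Gamma w)^-1 * normM (smp_H w) (grad f x) ^+ 2}.
Hypothesis HGH_int : mx_integrable P
  (fun w => smp_gamma w ^- 2 *: (smp_H w *m invmx G *m smp_H w)).
Hypothesis H_int : mx_integrable P (fun w => smp_gamma w ^- 2 *: smp_H w).
Hypothesis nu_le : loewner_le
  (mx_expectation P
    (fun w => smp_gamma w ^- 2 *: (smp_H w *m invmx G *m smp_H w)))
  (nu *: mx_expectation P (fun w => smp_gamma w ^- 2 *: smp_H w)).
Hypothesis tau_le : {ae P, forall w,
  tau <= smp_gamma w / Num.sqrt (smp_Gamma w) * Num.sqrt (mu / nu)}.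
Hypotheses (fs_xs : f xs = fs) (fs_le : forall u, fs <= f u).

Let N := invmx G.
Let N_psd : possemidefmx N. Proof. exact/posdefmxW/posdefmx_inv. Qed.

(** The step-size condition, squared and multiplied by
nu / (2 * mu) * gamma ^- 2. *)
Lemma step_size_bound (w : sample R n) :
  tau <= smp_gamma w / Num.sqrt (smp_Gamma w) * Num.sqrt (mu / nu) ->
  tau ^+ 2 * nu / (2 * mu) * smp_gamma w ^- 2 <= (2 * smp_Gamma w)^-1.
Proof.
have g0 := smp_gamma_gt0 w; have G0 := smp_Gamma_gt0 w.
have [/andP[t0 _]] := tau01.
rewrite -(ler_pXn2r (n := 2))//; last 2 first.
- by rewrite nnegrE ltW.
- by rewrite nnegrE !mulr_ge0 ?invr_ge0 ?sqrtr_ge0// ltW.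
have q0 : 0 <= mu / nu by rewrite divr_ge0 ?ltW.
rewrite !exprMn exprVn (sqr_sqrtr q0) (sqr_sqrtr (ltW G0)) => tau2.
have k0 : 0 <= nu / (2 * mu) * smp_gamma w ^- 2.
  by rewrite mulr_ge0// ?divr_ge0 ?invr_ge0 ?mulr_ge0 ?exprn_ge0// ltW.
have -> : tau ^+ 2 * nu / (2 * mu) * smp_gamma w ^- 2 =
    tau ^+ 2 * (nu / (2 * mu) * smp_gamma w ^- 2) by rewrite !mulrA.
apply: le_trans (ler_wpM2r k0 tau2) _.
rewrite le_eqVlt; apply/orP; left; apply/eqP.
by field; rewrite !gt_eqF.
Qed.

(** The averaging step: conditionally on the current iterates, the Lyapunov value
contracts by 1 - tau in mean. *)
Lemma one_step_expectation y z :
  (\int[P]_w (next_lyapunov f mu tau fs N xs y z w)%:E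
     <= ((1 - tau) * lyapunov f mu fs N xs y z)%:E)%E.
Proof.
have [t0 t1] := andP tau01.
pose x := coupling tau y z; pose g := grad f x.
pose a := z + tau *: (x - z) - xs.
pose c0 := f x - fs + mu / 2 * dotv a (N *m a).
(* the almost sure upper bound is
   c0 - tau <N a, gamma^-1 H g> + tau^2 / (2 mu) <g, gamma^-2 H N H g>
      - tau^2 nu / (2 mu) <g, gamma^-2 H g> *)
have hE := has_meanD (has_mean_cst P c0)
  (has_meanD (has_meanZ (- tau) (has_mean_dotv (N *m a) g G_int))
  (has_meanD (has_meanZ (tau ^+ 2 / (2 * mu)) (has_mean_dotv g g HGH_int))
     (has_meanZ (- (tau ^+ 2 * nu / (2 * mu))) (has_mean_dotv g g H_int)))).
apply: le_trans.
  apply: (ae_le_mean _ _ _ hE).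
  - by move=> w; apply: lyapunov_ge0 => //; exact: ltW.
  - apply: (measurable_next_lyapunov _ _ _ _ _ _ (om := id)) => //.
  - apply: (filterS2 _ _ tau_le (f_desc x)).
      exact: (ae_filter_ringOfSetsType P).
    move=> w /step_size_bound tw fw.
    have H_psd := smp_H_psd w; have p3 := proj2 H_psd g.
    have aE : next_z f mu tau x z w - xs
        = a - (tau / (mu * smp_gamma w)) *: (smp_H w *m g).
      by rewrite /next_z scalerBr scalerA -/g addrA [LHS]addrAC.
    rewrite /next_lyapunov -/x /lyapunov aE normM_sqr//.
    rewrite dotv_sub_mulmx; [|exact: (proj1 N_psd)|exact: (proj1 H_psd)].
    rewrite normM_sqr// in fw.
    rewrite -!scalemxAl -/N !dotvZr /c0.
    have := ler_wpM2r p3 tw; move: fw p3; rewrite -/g.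
    move: (dotv g (smp_H w *m g)) (dotv (N *m a) _) (dotv a _).
    move: (dotv g (smp_H w *m N *m smp_H w *m g)) => r5 r3 r2 r4 fw _ r3w.
    have m0 : mu != 0 by rewrite gt_eqF.
    have g0 : smp_gamma w != 0 by rewrite gt_eqF// smp_gamma_gt0.
    have -> : mu / 2 * (r4 - 2 * (tau / (mu * smp_gamma w)) * r2
          + (tau / (mu * smp_gamma w)) ^+ 2 * r5)
        = mu / 2 * r4 - tau * ((smp_gamma w)^-1 * r2)
          + tau ^+ 2 / (2 * mu) * (smp_gamma w ^- 2 * r5).
      by field; rewrite m0 g0.
    rewrite -addrA mulrA in r3w *.
    move: (tau ^+ 2 * nu / (2 * mu)) r3w => k r3w.
    rewrite !mulNr; lra.
(* it remains to bound the mean of [h] *)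
rewrite lee_fin -G_mean.
have [_ /(_ g)] := nu_le; rewrite mulmxBl dotvBr -scalemxAl dotvZr subr_ge0.
set e1 := dotv g _; set e2 := dotv g _ => e12.
have -> : dotv (N *m a) (G *m g) = dotv a g.
  by rewrite -(dotv_symmx _ _ (proj1 N_psd)) mulKmx// posdefmx_unit.
have /(couplingP x y z t0) xyz : x = coupling tau y z by [].
have sc v : f x + dotv g (v - x) + mu / 2 * dotv (v - x) (N *m (v - x)) <= f v.
  by have := f_sc x v; rewrite normM_sqr.
have t01 : 0 <= tau <= 1 by rewrite t1 ltW.
have := nesterov_contraction N_psd (ltW mu_gt0) t01 xyz (sc y) (sc xs).
rewrite /lyapunov normM_sqr// fs_xs -/a -/g; apply: le_trans.
have : tau ^+ 2 / (2 * mu) * (nu * e2 - e1) >= 0.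
  by rewrite mulr_ge0 ?subr_ge0// divr_ge0 ?sqr_ge0 ?mulr_ge0 ?ltW.
rewrite /c0; lra.
Qed.

End one_step.

(** * Independence of the past and the next sample *)

Section independence.
Context d (W : measurableType d) (R : realType) (Q : probability W R).

Section tonelli.
Context d1 (U : measurableType d1) d2 (T : measurableType d2).
Variables (Y : {RV Q >-> U}) (X : {RV Q >-> T}) (P : probability T R).
Hypothesis YX : forall A B, measurable A -> measurable B ->
  (Q (Y @^-1` A `&` X @^-1` B) = Q (Y @^-1` A) * P B)%E.

(** The joint law of (Y, X) agrees with the product of the laws on rectangles,
hence is the product measure, and the integral can be computed iteratively. *)
Lemma independent_tonelli (Phi : U * T -> \bar R) A :
  measurable_fun setT Phi -> (forall p, 0 <= Phi p)%E -> measurable A ->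
  (\int[Q]_(w in Y @^-1` A) Phi (Y w, X w) =
   \int[distribution Q Y]_(a in A) \int[P]_t Phi (a, t))%E.
Proof.
move=> mPhi Phi0 mA.
have mZ : measurable_fun setT (fun w => (Y w, X w)) by exact: measurable_fun_pair.
pose Zm := isMeasurableFun.Build _ _ _ _ _ mZ.
pose Z : {RV Q >-> (U * T)%type} := HB.pack (fun w => (Y w, X w)) Zm.
pose PhiA := (Phi \_ (A `*` setT))%E.
have mPhiA : measurable_fun setT PhiA.
  apply/(measurable_restrictT _ (measurableX mA measurableT)).
  exact: measurable_funTS.
have PhiA0 p : (0 <= PhiA p)%E by rewrite /PhiA patchE; case: ifP.
transitivity (\int[distribution Q Z]_p PhiA p)%E.
  rewrite ge0_integral_distribution// integral_mkcond; apply: eq_integral => w _.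
  rewrite /PhiA !patchE /=; congr (if _ then _ else _).
  by apply/idP/idP; rewrite !inE /=; [split|case].
transitivity (\int[distribution Q Y \x P]_p PhiA p)%E.
  apply: eq_measure_integral => B mB _; apply: esym.
  by apply: product_measure_unique => // B1 B2 mB1 mB2; exact: YX.
rewrite fubini_tonelli1// [RHS]integral_mkcond; apply: eq_integral => a _.
rewrite /fubini_F patchE /PhiA; case: ifPn => aA.
  by apply: eq_integral => t _; rewrite patchE ifT// inE/=; split=> //; rewrite -inE.
apply: integral0_eq => t _; rewrite patchE ifF//; apply/negbTE.
by apply: contra aA; rewrite !inE => -[].
Qed.

End tonelli.

Section past.
Context d' (T : measurableType d') (X : nat -> {RV Q >-> T}) (k : nat).
Hypothesis indepX : mutually_independent X.

(** The generating family in [g_sigma_preimage], repeated so that W can carry the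
sigma-algebra of the first k variables as a measurable type. *)
Definition past_generators : set (set W) :=
  \big[setU/set0]_(i < k) preimage_set_system setT (X i : W -> T) measurable.

Definition past := g_sigma_algebraType past_generators.

Let cylinder (A : nat -> set T) : set W :=
  \big[setI/setT]_(j <- iota 0 k) (X j @^-1` A j).

Let cylinders : set (set W) :=
  [set cylinder A | A in [set A | forall j, measurable (A j)]].

Lemma past_generator (i : 'I_k) A : measurable A ->
  past_generators (X i @^-1` A).
Proof.
by move=> mA; rewrite /past_generators (bigD1 i)//=; left; exists A; rewrite ?setTI.
Qed.

Lemma past_generatorsP C : past_generators C ->
  exists2 i, (i < k)%N & exists2 A, measurable A & C = X i @^-1` A.
Proof.
rewrite /past_generators; elim/big_ind: _ => [[]|S1 S2 h1 h2 [/h1|/h2]//|i _].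
by move=> [A mA <-]; exists i => //; exists A; rewrite ?setTI.
Qed.

Lemma past_measurable (C : set past) : measurable C -> d.-measurable (C : set W).
Proof.
apply: smallest_sub => [|_ /past_generatorsP[i _ [A mA ->]]].
  exact: sigma_algebra_measurable.
by rewrite -[X in measurable X]setTI; exact: measurable_funP.
Qed.

(** Both sides are finite measures in C.  By mutual independence they agree on the
cylinders, which are stable under intersection and generate the past. *)
Lemma past_indep (C : set past) B : measurable C -> measurable B ->
  Q ((C : set W) `&` X k @^-1` B) = (Q (C : set W) * Q (X k @^-1` B))%E.
Proof.
move=> mC mB.
have mXB : measurable (X k @^-1` B).
  by rewrite -[X in measurable X]setTI; exact: measurable_funP.
have mcyl : cylinders `<=` measurable.
  move=> _ [A mA <-]; rewrite /cylinder; elim: (iota 0 k) => [|j s IHs].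
    by rewrite big_nil.
  rewrite big_cons; apply: measurableI => //.
  by rewrite -[X in measurable X]setTI; exact: measurable_funP.
have cylT : cylinders setT.
  by exists (fun=> setT) => //; rewrite /cylinder big1// => j _; rewrite preimage_setT.
pose q := NngNum (fine_ge0 (measure_ge0 Q (X k @^-1` B))).
have qE : q%:num%:E = Q (X k @^-1` B) by rewrite /= fineK// fin_num_measure.
suff : mrestr Q mXB C = mscale q Q C by rewrite muleC -qE.
apply: (g_sigma_algebra_measure_unique cylinders mcyl (fun=> setT)) => //.
- by rewrite bigcup_const//; exists 0%N.
- move=> _ _ [A1 mA1 <-] [A2 mA2 <-].
  exists (fun j => A1 j `&` A2 j); first by move=> j; exact: measurableI.
  by rewrite /cylinder -big_split.
- move=> _ [A mA <-]; change (Q (cylinder A `&` X k @^-1` B) = q%:num%:E * Q (cylinder A))%E.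
  (* the event on the indices up to k *)
  pose A' j := if j == k then B else A j.
  have A'E : \big[setI/setT]_(j <- iota 0 k) (X j @^-1` A' j) = cylinder A.
    apply: eq_big_seq => j; rewrite mem_iota add0n /A' => /= jk.
    by rewrite ifF// ltn_eqF.
  have A'E2 : (\prod_(j <- iota 0 k) Q (X j @^-1` A' j) =
      \prod_(j <- iota 0 k) Q (X j @^-1` A j))%E.
    apply: eq_big_seq => j; rewrite mem_iota add0n /A' => /= jk.
    by rewrite ifF// ltn_eqF.
  have /= := @indepX (k :: iota 0 k) A'.
  rewrite iota_uniq mem_iota add0n ltnn andbF !big_cons A'E A'E2 /A' eqxx.
  rewrite -indepX ?iota_uniq// setIC qE; apply=> // j; by case: ifP.
- move=> _; change (Q (setT `&` X k @^-1` B) < +oo)%E.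
  by rewrite setTI ltey_eq fin_num_measure.
- apply: smallest_sub mC; first exact: smallest_sigma_algebra.
  move=> _ /past_generatorsP[i ik [A mA ->]]; apply: sub_sigma_algebra.
  exists (fun j => if j == i then A else setT); first by move=> j; case: ifP.
  rewrite /cylinder (bigD1_seq i) ?iota_uniq ?mem_iota//= eqxx big1 ?setIT//.
  by move=> j /negbTE ->; rewrite preimage_setT.
Qed.

End past.

End independence.

(** * Conditioning on the past *)

Section conditioning.
Context d (W : measurableType d) (R : realType) (Q : probability W R).
Context d' (T : measurableType d') (X : nat -> {RV Q >-> T}) (k : nat).
Local Notation Past := (past X k).

(** The identity, seen as a random variable whose target carries only the
information of the past. *)
Definition past_map (w : W) : Past := w.

Lemma measurable_past_map : measurable_fun setT past_map.
Proof. by move=> _ A /past_measurable; rewrite setTI. Qed.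

HB.instance Definition _ :=
  isMeasurableFun.Build _ _ W Past past_map measurable_past_map.

Definition past_id : {RV Q >-> Past} := past_map.

Lemma past_measurable_fun (Z : W -> R) :
  measurable_fun setT (Z : Past -> R) -> measurable_fun setT Z.
Proof. by move=> mZ; exact: measurableT_comp mZ measurable_past_map. Qed.

Lemma past_obs i : (i < k)%N -> measurable_fun setT (X i : Past -> T).
Proof.
move=> ik _ A mA; rewrite setTI; apply: sub_sigma_algebra.
exact: (past_generator X (Ordinal ik) mA).
Qed.

(** Both versions are random variables on the past with the same integral over
each event of the past. *)
Lemma cond_expectation_unique (V Z1 Z2 : W -> R) :
  is_cond_expectation Q (g_sigma_preimage (fun i : 'I_k => X i : W -> T)) V Z1 ->
  is_cond_expectation Q (g_sigma_preimage (fun i : 'I_k => X i : W -> T)) V Z2 ->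
  {ae Q, forall w, Z1 w = Z2 w}.
Proof.
move=> [_ i1 m1 e1] [_ i2 m2 e2].
have mZ (Z : W -> R) : (forall B : set R, measurable B ->
    g_sigma_preimage (fun i : 'I_k => X i : W -> T) (Z @^-1` B)) ->
    measurable_fun setT (Z : Past -> R).
  by move=> m _ B mB; rewrite setTI; exact: m.
have intS (Z : W -> R) : measurable_fun setT (Z : Past -> R) ->
    Q.-integrable setT (EFin \o Z) ->
    (distribution Q past_id).-integrable setT (EFin \o Z : Past -> _).
  move=> mZS iZ; apply: integrable_pushforward => //.
  exact/measurable_EFinP.
have mS (Z : W -> R) : (forall B : set R, measurable B ->
    g_sigma_preimage (fun i : 'I_k => X i : W -> T) (Z @^-1` B)) ->
    measurable_fun setT (EFin \o Z : Past -> _).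
  by move=> m; apply/measurable_EFinP; exact: mZ.
have iA (Z : W -> R) (A : set Past) : Q.-integrable setT (EFin \o Z) ->
    measurable A -> Q.-integrable (past_map @^-1` A) ((EFin \o Z : Past -> _) \o past_map).
  move=> iZ /past_measurable mA.
  exact: (integrableS measurableT mA (@subsetT _ _) iZ).
have ae12 : ae_eq (distribution Q past_id) setT
    (EFin \o Z1 : Past -> _) (EFin \o Z2 : Past -> _).
  apply: integral_ae_eq => //.
  - exact: intS (mZ _ m1) i1.
  - exact: mS m2.
  - move=> A _ mA.
    transitivity (\int[Q]_(w in (A : set W)) (Z1 w)%:E)%E.
      exact: (integral_pushforward measurable_past_map (mS _ m1) (iA _ _ i1 mA)).
    rewrite e1// -e2//; apply/esym.
    exact: (integral_pushforward measurable_past_map (mS _ m2) (iA _ _ i2 mA)).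
have [N [mN QN sub]] := ae12.
exists N; split; first exact: past_measurable.
  exact: QN.
by move=> w Zw; apply: sub => /(_ I) [].
Qed.

Variable P : probability T R.
Hypothesis X_law : forall A, measurable A -> distribution Q (X k) A = P A.
Hypothesis indepX : mutually_independent X.

(** Substituting the k-th variable for t and conditioning on the past amounts to
integrating out t while the past stays fixed.  The bound b makes the inner
integral finite and integrable. *)
Lemma freezing (Phi : Past * T -> R) (b : W -> R) :
  measurable_fun setT Phi -> (forall p, 0 <= Phi p) ->
  Q.-integrable setT (EFin \o b) ->
  (forall w : Past, \int[P]_t (Phi (w, t))%:E <= (b w)%:E)%E ->
  is_cond_expectation Q (g_sigma_preimage (fun i : 'I_k => X i : W -> T))
    (fun w => Phi (w, X k w)) (fun w => fine (\int[P]_t (Phi (w, t))%:E)).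
Proof.
move=> mPhi Phi0 ib Phib.
pose E (w : Past) := (\int[P]_t (Phi (w, t))%:E)%E.
have E0 w : (0 <= E w)%E by apply: integral_ge0 => t _; rewrite lee_fin.
have EE w : (fine (E w))%:E = E w.
  by rewrite fineK// ge0_fin_numE// (le_lt_trans (Phib w))// ltry.
have mEPhi : measurable_fun setT (EFin \o Phi) by exact/measurable_EFinP.
have mE : measurable_fun setT E.
  exact: (measurable_fun_fubini_tonelli_F (m2 := P) (EFin \o Phi)).
have mfE : measurable_fun setT (fun w : Past => fine (E w)).
  by apply/measurable_EFinP; apply: eq_measurable_fun mE => w _ /=; rewrite EE.
have intE (A : set Past) : measurable A ->
    (\int[Q]_(w in (A : set W)) (fine (E w))%:E =
     \int[Q]_(w in (A : set W)) (Phi (w, X k w))%:E)%E.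
  move=> mA; transitivity (\int[distribution Q past_id]_(w in A) E w)%E.
    rewrite ge0_integral_pushforward//; last exact: measurable_funTS.
    by apply: eq_integral => w _; rewrite EE.
  have YX (A1 : set Past) B : measurable A1 -> measurable B ->
      (Q (past_id @^-1` A1 `&` X k @^-1` B) = Q (past_id @^-1` A1) * P B)%E.
    by move=> mA1 mB; rewrite -X_law//; exact: past_indep.
  by have <- := independent_tonelli YX mEPhi (fun p => Phi0 p) mA.
have iE : Q.-integrable setT (EFin \o (fun w : W => fine (E w))).
  apply: le_integrable ib => //.
    by apply/measurable_EFinP; exact: past_measurable_fun mfE.
  move=> w _; rewrite /= lee_fin ger0_norm ?fine_ge0// -lee_fin EE.
  by rewrite (le_trans (Phib w))// lee_fin ler_norm.
have mPX : measurable_fun setT (fun w => Phi (w, X k w)).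
  apply: measurableT_comp mPhi _; apply: measurable_fun_pair => //.
  exact: measurable_past_map.
split=> //.
- apply/integrableP; split; first exact/measurable_EFinP.
  under eq_integral do rewrite /= ger0_norm//.
  rewrite -(intE setT)//.
  have /integrableP[_] := iE.
  by under eq_integral do rewrite /= ger0_norm ?fine_ge0//.
- by move=> B mB; rewrite -[X in g_sigma_preimage _ X]setTI; exact: mfE.
Qed.

End conditioning.

(** * The accelerated iteration *)

Section iterates.
Variables (R : realType) (n : nat) (f : 'cV[R]_n -> R) (mu tau : R).
Hypotheses (df : forall x, differentiable f x) (mu_gt0 : 0 < mu).
Context d (T : measurableType d) (om : nat -> T -> Omega R n).
Variables (x0 : 'cV[R]_n) (y z : nat -> T -> 'cV[R]_n).
Hypotheses (y_0 : forall w, y 0%N w = x0) (z_0 : forall w, z 0%N w = x0).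
Hypothesis y_S : forall j w,
  y j.+1 w = next_y f (coupling tau (y j w) (z j w)) (om j w).
Hypothesis z_S : forall j w,
  z j.+1 w = next_z f mu tau (coupling tau (y j w) (z j w)) (z j w) (om j w).

Lemma mx_measurable_iterates k :
  (forall i, (i < k)%N -> measurable_fun setT (om i)) ->
  mx_measurable (y k) /\ mx_measurable (z k).
Proof.
elim: k => [_|k IHk mom].
  by rewrite (funext y_0) (funext z_0); split; exact: mx_measurable_cst.
have [my mz] : mx_measurable (y k) /\ mx_measurable (z k).
  by apply: IHk => i ik; apply: mom; exact: ltnW.
have mk := mom k (ltnSn k).
have mx := mx_measurable_coupling tau my mz.
rewrite (funext (y_S k)) (funext (z_S k)).
by split; [exact: mx_measurable_next_y|exact: mx_measurable_next_z].
Qed.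

End iterates.

Theorem theoremA3p1 (R : realType) (n : nat)
  (P : probability (Omega R n) R)
  (G : 'M[R]_n)
  (hGint : mx_integrable P (fun w => (smp_gamma w)^-1 *: smp_H w))
  (hG : G = mx_expectation P (fun w => (smp_gamma w)^-1 *: smp_H w))
  (hGpd : posdefmx G)
  (f : 'cV[R]_n -> R) (mu L : R)
  (hdiff : forall x, differentiable f x)
  (hmu : 0 < mu)
  (hsc : strongly_convex_wrt (invmx G) mu f)
  (hL : lipschitz_grad_wrt (invmx G) L f)
  (hdesc : forall x : 'cV[R]_n, {ae P, forall w,
     f (x - (smp_Gamma w)^-1 *: (smp_H w *m grad f x))
     <= f x - (2 * smp_Gamma w)^-1 * normM (smp_H w) (grad f x) ^+ 2})
  (nu : R) (hnu : 0 < nu)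
  (hint1 : mx_integrable P
     (fun w => smp_gamma w ^- 2 *: (smp_H w *m invmx G *m smp_H w)))
  (hint2 : mx_integrable P (fun w => smp_gamma w ^- 2 *: smp_H w))
  (hnuG : loewner_le
     (mx_expectation P
        (fun w => smp_gamma w ^- 2 *: (smp_H w *m invmx G *m smp_H w)))
     (nu *: mx_expectation P (fun w => smp_gamma w ^- 2 *: smp_H w)))
  (tau : R) (htau : 0 < tau)
  (htau1 : {ae P, forall w,
     tau <= smp_gamma w / Num.sqrt (smp_Gamma w) * Num.sqrt (mu / nu)})
  (htau2 : tau <= Num.sqrt (mu / L))
  (d : measure_display) (W : measurableType d) (Q : probability W R)
  (om : nat -> {RV Q >-> Omega R n})
  (hlaw : forall k (A : set (Omega R n)), measurable A ->
     distribution Q (om k) A = P A)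
  (hindep : mutually_independent om)
  (x0 : 'cV[R]_n) (x y z : nat -> W -> 'cV[R]_n)
  (hx0 : forall w, x 0%N w = x0)
  (hy0 : forall w, y 0%N w = x0)
  (hz0 : forall w, z 0%N w = x0)
  (hx : forall k w, tau *: (x k.+1 w - z k w) = y k w - x k.+1 w)
  (hy : forall k w, y k.+1 w = x k.+1 w
     - (smp_Gamma (om k w))^-1 *: (smp_H (om k w) *m grad f (x k.+1 w)))
  (hz : forall k w, z k.+1 w - z k w = tau *: (x k.+1 w - z k w
     - (mu * smp_gamma (om k w))^-1
         *: (smp_H (om k w) *m grad f (x k.+1 w))))
  (xstar : 'cV[R]_n) (fstar : R)
  (hfstar : f xstar = fstar) (hmin : forall u, fstar <= f u)
  (V : nat -> W -> R)
  (hV : forall k w, V k w =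
     f (y k w) - fstar + mu / 2 * normM (invmx G) (z k w - xstar) ^+ 2)
  (k : nat) :
  let F := g_sigma_preimage (fun i : 'I_k => om i : W -> Omega R n) in
  (exists Ek, is_cond_expectation Q F (V k.+1) Ek) /\
  (forall Ek, is_cond_expectation Q F (V k.+1) Ek ->
     {ae Q, forall w, Ek w <= (1 - tau) * V k w}).
Proof.
have N_psd : possemidefmx (invmx G) by exact/posdefmxW/posdefmx_inv.
have mu_ge0 := ltW hmu.
pose lyap := lyapunov f mu fstar (invmx G) xstar.
pose next := next_lyapunov f mu tau fstar (invmx G) xstar.
have xE j w : x j.+1 w = coupling tau (y j w) (z j w).
  exact: (proj1 (couplingP _ _ _ htau) (hx j w)).
have yE j w : y j.+1 w = next_y f (coupling tau (y j w) (z j w)) (om j w).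
  by rewrite hy xE.
have zE j w : z j.+1 w
    = next_z f mu tau (coupling tau (y j w) (z j w)) (z j w) (om j w).
  by rewrite /next_z -xE -hz addrC subrK.
have VS j w : V j.+1 w = next (y j w) (z j w) (om j w).
  by rewrite hV yE zE.
have step u v : (\int[P]_w (next u v w)%:E <= ((1 - tau) * lyap u v)%:E)%E.
  (* in dimension 0 the bound tau <= 1 may fail, but every value is 0 *)
  have [n0|n0] := posnP n.
    have flat (a b : 'cV[R]_n) : a = b.
      by apply/matrixP => i; have := ltn_ord i; rewrite {2}n0.
    have lyap0 a b : lyap a b = 0.
      rewrite /lyap /lyapunov (flat a xstar) (flat b xstar) hfstar !subrr add0r.
      by rewrite normM_sqr// mulmx0 /dotv mulmx0 mxE mulr0.
    rewrite lyap0 mulr0 integral0_eq// => w _; congr EFin; exact: lyap0.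
  have t01 : 0 < tau <= 1.
    by rewrite htau (modulus_le1 n0 (posdefmx_inv hGpd) hmu hsc hL).
  exact: (one_step_expectation hG hGint hGpd hmu hnu t01 hdiff hsc hdesc
    hint1 hint2 hnuG htau1 hfstar hmin).
pose Phi j (p : past om j * Omega R n) := next (y j p.1) (z j p.1) p.2.
have mPhi j : measurable_fun setT (Phi j).
  have [my mz] := @mx_measurable_iterates R n f mu tau hdiff hmu _ (past om j)
    (fun i => om i) x0 y z hy0 hz0 yE zE j (@past_obs _ _ _ _ _ _ om j).
  apply: measurable_next_lyapunov => //.
  - by move=> i l; exact: measurableT_comp (my i l) measurable_fst.
  - by move=> i l; exact: measurableT_comp (mz i l) measurable_fst.
have next_ge0 u v w : 0 <= next u v w by exact: lyapunov_ge0.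
pose E j w := (\int[P]_t (next (y j w) (z j w) t)%:E)%E.
have E_le j w : (E j w <= ((1 - tau) * V j w)%:E)%E.
  by rewrite hV; exact: step.
have cond j : Q.-integrable setT (EFin \o V j) ->
    is_cond_expectation Q
      (g_sigma_preimage (fun i : 'I_j => om i : W -> Omega R n))
      (V j.+1) (fun w => fine (E j w)).
  move=> iV.
  rewrite (_ : V j.+1 = fun w => Phi j (w, om j w)); last exact/funext/VS.
  apply: (@freezing _ W R Q _ (Omega R n) om j P (hlaw j) hindep (Phi j)
    (fun w => (1 - tau) * V j w)) => [|p||w].
  - exact: mPhi.
  - exact: next_ge0.
  - exact: (integrableZl measurableT (1 - tau) iV).
  - exact: E_le.
have V_int j : Q.-integrable setT (EFin \o V j).
  elim: j => [|j /cond[]//].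
  rewrite (_ : V 0%N = fun=> lyap x0 x0).
    exact: finite_measure_integrable_cst.
  by apply/funext => w; rewrite hV hy0 hz0.
split; first by exists (fun w => fine (E k w)); exact/cond/V_int.
move=> Ek hEk; have hE := cond k (V_int k).
have := cond_expectation_unique hEk hE; apply: filterS => w ->.
rewrite -lee_fin fineK ?E_le// ge0_fin_numE; first exact: le_lt_trans (E_le k w) (ltry _).
by apply: integral_ge0 => t _; rewrite lee_fin.
Qed.
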